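(* Let $u(t)=\sup_{s\in\mathbb{R}^d}\big(\langle t,s\rangle-q(s)\big)$ for $t\in\Sigma$. Then $$\lim_{n\to\infty}\ \sup_{\alpha\in n\Sigma\cap\mathbb{Z}_+^d}\left|\frac1{2n}\log I_{\alpha,n}-u(\alpha/n)\right|=0 .$$ Consequently, $$\lim_{n\to\infty}\ \sup_{\alpha\in n\Sigma\cap\mathbb{Z}_+^d}\left|\frac1n\log c_{\alpha,n}+u(\alpha/n)\right|=0 .$$
   Context: Let $d\ge1$ and let $Q:\mathbb{C}^d\to[0,\infty)$ be a $\mathscr{C}^2$ function that is torus-invariant, i.e. $Q(z_1,\dots,z_d)=Q(|z_1|,\dots,|z_d|)$. Assume there exist $\varepsilon>0$ and $R\ge1$ such that $Q(z)\ge(1+\varepsilon)\log\|z\|$ for $\|z\|\ge R$, where $\|\cdot\|$ is the Euclidean norm. Let $\Sigma=\{t\in[0,\infty)^d:\sum_{j=1}^d t_j\le1\}$ be the standard simplex, $\mathbb{Z}_+^d=\{0,1,2,\dots\}^d$ and $n\Sigma=\{nt:t\in\Sigma\}$ (so $\alpha\in n\Sigma\cap\mathbb{Z}_+^d$ means $|\alpha|=\alpha_1+\dots+\alpha_d\le n$). Put $q(s)=Q(e^{s_1},\dots,e^{s_d})$ for $s\in\mathbb{R}^d$. The function $u$ is finite and continuous on $\Sigma$. Set $n_0=\lfloor d/\varepsilon\rfloor+1$. For $n\ge n_0$ and $\alpha\in n\Sigma\cap\mathbb{Z}_+^d$ let $$I_{\alpha,n}=\int_{\mathbb{C}^d}|z^\alpha|^2e^{-2nQ(z)}\,dV_d(z),\qquad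 c_{\alpha,n}=I_{\alpha,n}^{-1/2},$$ where $dV_d$ is Lebesgue measure on $\mathbb{C}^d$ and $z^\alpha=z_1^{\alpha_1}\cdots z_d^{\alpha_d}$; these integrals are finite for $n\ge n_0$. *)

(* Defs.v *)
From HB Require Import structures.
From mathcomp Require Import all_boot all_order all_algebra.
From mathcomp Require Import all_classical all_reals all_analysis.
From mathcomp Require Export complex.

Set Implicit Arguments.
Unset Strict Implicit.
Unset Printing Implicit Defensive.

Import Order.TTheory GRing.Theory Num.Theory.
Import numFieldNormedType.Exports.
Import Normc.

Local Open Scope classical_set_scope.
Local Open Scope ring_scope.
Local Open Scope complex_scope.

(* Row j of x carries the real and imaginary parts of the j-th coordinate. *)
Definition mx_to_C (R : realType) (d : nat) (x : 'M[R]_(d, 2)) : 'rV[R[i]]_d :=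
  \row_j (x j 0 +i* x j 1).

(* All first partial derivatives exist everywhere and are continuous; this
   implies the continuity of f itself. *)
Definition C1 (R : realType) (m n : nat) (f : 'M[R]_(m, n) -> R^o) : Prop :=
  forall i j, (forall x, derivable f x (delta_mx i j)) /\
              continuous (fun x => 'D_(delta_mx i j) f x).

Definition C2 (R : realType) (m n : nat) (f : 'M[R]_(m, n) -> R^o) : Prop :=
  C1 f /\ forall i j, C1 (fun x => 'D_(delta_mx i j) f x).

Definition C2_Cd (R : realType) (d : nat) (Q : 'rV[R[i]]_d -> R) : Prop :=
  C2 (fun x : 'M[R]_(d, 2) => Q (mx_to_C x)).

Definition torus_invariant (R : realType) (d : nat)
    (Q : 'rV[R[i]]_d -> R) : Prop :=
  forall z, Q z = Q (map_mx (fun w => (normc w)%:C) z).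

Definition enorm (R : realType) (d : nat) (z : 'rV[R[i]]_d) : R :=
  Num.sqrt (\sum_j normc (z 0 j) ^+ 2).

Section pushforward_bij.
Context d1 d2 (T1 : measurableType d1) (T2 : measurableType d2) (R : realType).
Variables (m : {sigma_finite_measure set T1 -> \bar R}).
Variables (f : T1 -> T2) (g : T2 -> T1).

Definition pushforward_bij of measurable_fun setT f & measurable_fun setT g
  & cancel f g : set T2 -> \bar R := pushforward m f.

Hypotheses (mf : measurable_fun setT f) (mg : measurable_fun setT g).
Hypothesis fK : cancel f g.

HB.instance Definition _ := Measure.copy (pushforward_bij mf mg fK)
  (measure_function_pushforward__canonical__measure_function_Measure m mf).

Let pushforward_bij_sigma_finite :
  sigma_finite setT (pushforward_bij mf mg fK).
Proof.
have [F TF Foo] := sigma_finiteT m.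
exists (fun k => g @^-1` F k).
  by rewrite -preimage_bigcup -TF preimage_setT.
move=> k; have [mFk Fkoo] := Foo k; split.
  by rewrite -[X in measurable X]setTI; exact: mg.
rewrite /pushforward_bij /pushforward -comp_preimage.
by rewrite (_ : g \o f = id) ?preimage_id//; apply/funext => x /=; rewrite fK.
Qed.

HB.instance Definition _ := Measure_isSigmaFinite.Build _ _ _
  (pushforward_bij mf mg fK) pushforward_bij_sigma_finite.

End pushforward_bij.

(* The canonical sigma-finite structure on m1 \x m2 is only inferred for
   subprobabilities, so the product is repackaged here for general m1, m2. *)
Section product_sigma_finite.
Context d1 d2 (T1 : measurableType d1) (T2 : measurableType d2) (R : realType).
Variables (m1 : {sigma_finite_measure set T1 -> \bar R})
  (m2 : {sigma_finite_measure set T2 -> \bar R}).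

Definition product_sf : set (T1 * T2)%type -> \bar R := (m1 \x m2)%E.

HB.instance Definition _ := Measure.copy product_sf (m1 \x m2)%E.

Let product_sf_sigma_finite : sigma_finite setT product_sf.
Proof.
have /sigma_finiteP[F [TF ndF Foo]] := sigma_finiteT m1.
have /sigma_finiteP[G [TG ndG Goo]] := sigma_finiteT m2.
exists (fun n => F n `*` G n).
  rewrite -setXTT TF TG predeqE => -[x y]; split.
    move=> [/= [n _ Fnx] [k _ Gky]]; exists (maxn n k) => //; split.
    - by move: x Fnx; exact/subsetPset/ndF/leq_maxl.
    - by move: y Gky; exact/subsetPset/ndG/leq_maxr.
  by move=> [n _ []/= ? ?]; split; exists n.
move=> k; have [? ?] := Foo k; have [? ?] := Goo k.
split; first exact: measurableX.
by rewrite /product_sf product_measure1E// lte_mul_pinfty// ge0_fin_numE.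
Qed.

HB.instance Definition _ := Measure_isSigmaFinite.Build _ _ _ product_sf
  product_sf_sigma_finite.

End product_sigma_finite.

Section tuple_measure.
Context disp (T : measurableType disp) (R : realType).
Variable m : {sigma_finite_measure set T -> \bar R}.

Definition tcons (n : nat) (p : T * n.-tuple T) : n.+1.-tuple T :=
  [tuple of p.1 :: p.2].

Definition tuncons (n : nat) (t : n.+1.-tuple T) : T * n.-tuple T :=
  (thead t, [tuple of behead t]).

Lemma measurable_tcons n : measurable_fun setT (@tcons n).
Proof. exact: measurable_cons. Qed.

Lemma measurable_tuncons n : measurable_fun setT (@tuncons n).
Proof.
apply: measurable_fun_pair; first exact: measurable_tnth.
exact: measurable_behead.
Qed.

Lemma tconsK n : cancel (@tcons n) (@tuncons n).
Proof. by move=> [z t]; congr pair; apply/val_inj. Qed.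

(* The n-fold product measure m \x ... \x m on n.-tuple T. *)
Fixpoint tuple_measure (n : nat) :
    {sigma_finite_measure set (n.-tuple T) -> \bar R} :=
  match n with
  | 0 => \d_([tuple] : 0.-tuple T)
  | k.+1 => pushforward_bij (product_sf m (tuple_measure k))
      (@measurable_tcons k) (@measurable_tuncons k) (@tconsK k)
  end.

Lemma tuple_measure_box n (B : 'I_n -> set T) : (forall i, measurable (B i)) ->
  (tuple_measure n [set t | forall i, B i (tnth t i)] =
   \prod_(i < n) m (B i))%E.
Proof.
elim: n B => [|n IH] B mB.
  by rewrite big_ord0 /= diracE mem_set//; case.
rewrite big_ord_recl.
set E := (X in tuple_measure _ X = _).
rewrite -[LHS]/((m \x tuple_measure n)%E (@tcons n @^-1` E)) {}/E.
have -> : @tcons n @^-1` [set t | forall i, B i (tnth t i)] =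
    B ord0 `*` [set t | forall i, B (lift ord0 i) (tnth t i)].
  apply/seteqP; split=> -[x t] /=.
    move=> H; split; first exact: (H ord0).
    by move=> i; have := H (lift ord0 i); rewrite /tcons /= tnthS.
  move=> [H0 H1] i; case: (unliftP ord0 i) => [j ->|->]; last by [].
  by rewrite /tcons tnthS; apply: H1.
have mE : measurable
    [set t : n.-tuple T | forall i, B (lift ord0 i) (tnth t i)].
  rewrite (_ : [set _ | _] = \bigcap_(i in [set: 'I_n])
      ((fun t : n.-tuple T => tnth t i) @^-1` B (lift ord0 i))).
    apply: fin_bigcap_measurable; first exact: finite_finset.
    move=> i _; rewrite -[X in measurable X]setTI; exact: measurable_tnth.
  by apply/seteqP; split=> [t H i _|t H i]; [exact: H|exact: (H i)].
by rewrite product_measure1E//; congr (_ * _)%E; apply: IH.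
Qed.

End tuple_measure.

(* Lebesgue measure on C = R * R and on C^d, the latter carried by d-tuples. *)
Definition lebesgue_C (R : realType) :
    {sigma_finite_measure set (measurableTypeR R * measurableTypeR R)%type ->
      \bar R} :=
  product_sf (@lebesgue_measure R) (@lebesgue_measure R).

Definition lebesgue_Cd (R : realType) (d : nat) :
    {sigma_finite_measure
      set (d.-tuple (measurableTypeR R * measurableTypeR R)) -> \bar R} :=
  tuple_measure (lebesgue_C R) d.

Definition tuple_to_C (R : realType) (d : nat)
    (p : d.-tuple (measurableTypeR R * measurableTypeR R)) : 'rV[R[i]]_d :=
  \row_j ((tnth p j).1 +i* (tnth p j).2).

Definition simplex (R : realType) (d : nat) : set 'rV[R]_d :=
  [set t | (forall j, 0 <= t 0 j) /\ \sum_j t 0 j <= 1].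
Arguments simplex : clear implicits.

Definition natv (R : realType) (d : nat) (alpha : 'rV[nat]_d) : 'rV[R]_d :=
  map_mx (fun k => k%:R) alpha.

(* The lattice points of the dilated simplex n Sigma. *)
Definition lattice_pts (R : realType) (d n : nat) : set 'rV[nat]_d :=
  [set alpha | [set n%:R *: t | t in simplex R d] (natv R alpha)].
Arguments lattice_pts : clear implicits.

Definition qexp (R : realType) (d : nat) (Q : 'rV[R[i]]_d -> R)
    (s : 'rV[R]_d) : R :=
  Q (map_mx (fun x => (expR x)%:C) s).

Definition u_fun (R : realType) (d : nat) (Q : 'rV[R[i]]_d -> R)
    (t : 'rV[R]_d) : \bar R :=
  ereal_sup (range (fun s : 'rV[R]_d =>
    ((\sum_j t 0 j * s 0 j) - qexp Q s)%:E)).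

Definition monomial (R : realType) (d : nat) (alpha : 'rV[nat]_d)
    (z : 'rV[R[i]]_d) : R[i] :=
  \prod_j z 0 j ^+ alpha 0 j.

Definition I_int (R : realType) (d : nat) (Q : 'rV[R[i]]_d -> R)
    (alpha : 'rV[nat]_d) (n : nat) : \bar R :=
  (\int[lebesgue_Cd R d]_p
    (normc (monomial alpha (tuple_to_C p)) ^+ 2 *
     expR (- (2 * n%:R * Q (tuple_to_C p))))%:E)%E.

(* I^(-1/2); poweR sends the infinite value to itself, but I is finite for all
   large n. *)
Definition c_coef (R : realType) (d : nat) (Q : 'rV[R[i]]_d -> R)
    (alpha : 'rV[nat]_d) (n : nat) : \bar R :=
  (I_int Q alpha n `^ (- 2^-1))%E.

(* Main.v *)
Require Import Defs.
From mathcomp Require Import all_boot all_order all_algebra.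
From mathcomp Require Import all_classical all_reals all_analysis.
From mathcomp Require Import measurable_realfun.
From mathcomp Require Import ring lra.

Set Implicit Arguments.
Unset Strict Implicit.
Unset Printing Implicit Defensive.

Import Order.TTheory GRing.Theory Num.Theory.
Import numFieldNormedType.Exports.
Import Normc HBNNSimple.

Local Open Scope classical_set_scope.
Local Open Scope ring_scope.

(** With t = alpha / n, the integrand of I_{alpha,n} is the square of
    P(z) = |z^alpha| e^{-nQ(z)}, and wherever no coordinate vanishes
    P = exp (n (<t,s> - q(s))) for s = log |z|.  Its supremum is e^{nu(t)}, so
    the claim is Laplace's principle, with bounds uniform in t.

    Upper bound.  P <= e^{nu(t)} holds on all of C^d (monomial_le_u_fun).  The
    growth of Q also gives P <= e^{n(A - eps ln T)}, where T = max(|z|, r0) and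
    A = (1 + eps) ln r0.  Using the second bound for a fixed number m of the n
    factors, and the first for the other n - m, yields
    P^2 <= e^{2(n-m)u(t)} e^{2mA} T^{-2m eps}.  For m large the last factor is
    integrable, with an integral independent of alpha and n (I_int_le).  After
    division of the logarithm by 2n the constants vanish in the limit, and the
    error - m u(t) / n is at most m q(0) / n because u >= -q(0), the term s = 0
    of the supremum.

    Lower bound.  If s nearly attains u(t), then <t,s> - q(s) >= -q(0) - delta;
    but the growth of Q bounds this value by A - eps ln T(e^s), so e^s lies in a
    ball independent of t.  On that ball Q is uniformly continuous.  Hence on
    the cube with corner e^s and a fixed small side eta the value of Q exceeds
    q(s) by little, while |z_j| >= e^{s_j} makes |z^alpha| at least its value
    at the corner.  This gives I >= eta^{2d} e^{2n(u(t) - delta)} (I_int_ge).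

    Uniform continuity of Q comes from its continuous partial derivatives,
    bounded on compact cubes: Q is Lipschitz there.

    For the coefficients, log c = -(log I)/2, so the second limit is the
    first one up to sign. *)

(** * Lipschitz bounds from continuous partial derivatives *)

(** The cube is the image of a product of segments under the homeomorphism
    vec_mx, which reduces compactness to Tychonoff's theorem for row vectors. *)
Lemma compact_mx_cube (R : realType) (m n : nat) (B : R) :
  compact [set M : 'M[R]_(m, n) | forall i j, `|M i j| <= B].
Proof.
have cv : continuous (vec_mx : 'rV[R]_(m * n) -> 'M[R]_(m, n)).
  move=> v A [P vP sPA].
  exists (fun=> fun k => [set t | forall i j, k = mxvec_index i j -> P i j t]).
    move=> i k; rewrite ord1; case/mxvec_indexP: k => a b.
    have := vP a b; rewrite mxE; apply: filterS => t Pt i' j' eq_ab.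
    have [g gK _] := curry_mxvec_bij m n.
    have [<- <-] : (a, b) = (i', j').
      by rewrite -(gK (a, b) isT) /= eq_ab; exact: (gK (i', j') isT).
    exact: Pt.
  by move=> w Pw; apply: sPA => i j; rewrite mxE; apply: (Pw ord0).
have -> : [set M : 'M[R]_(m, n) | forall i j, `|M i j| <= B] =
    vec_mx @` [set v : 'rV[R]_(m * n) | forall k, `[- B, B]%classic (v ord0 k)].
  apply/seteqP; split=> [M MB|_ [v vB <-] i j].
    exists (mxvec M); last exact: mxvecK.
    by move=> k /=; case/mxvec_indexP: k => i j; rewrite mxvecE in_itv/= -ler_norml.
  by rewrite mxE; have := vB (mxvec_index i j); rewrite /= in_itv/= -ler_norml.
apply: continuous_compact; first exact: continuous_subspaceT.
by apply: (@rV_compact R _ (fun=> `[- B, B]%classic)) => _; exact: segment_compact.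
Qed.

(** The mean value theorem on the segment from x to x + c e_ij: the condition
    0 <= h * c says that h lies on the same side of 0 as c. *)
Lemma partial_mean_value_le (R : realType) (m n : nat) (f : 'M[R]_(m, n) -> R^o)
    i j (x : 'M[R]_(m, n)) (c L : R) :
  (forall y, derivable f y (delta_mx i j)) ->
  (forall h, `|h| <= `|c| -> 0 <= h * c ->
     `|'D_(delta_mx i j) f (x + h *: delta_mx i j)| <= L) ->
  `|f (x + c *: delta_mx i j) - f x| <= L * `|c|.
Proof.
move=> df bf.
pose D := delta_mx i j : 'M[R]_(m, n).
pose g : R -> R := fun h => f (x + h *: D).
have gE (h : R) : (fun t : R => t^-1 *: ((g \o shift h) (t *: 1) - g h)) =
            (fun t : R => t^-1 *: ((f \o shift (x + h *: D)) (t *: D) - f (x + h *: D))).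
  apply/funext => t; rewrite /g /= /shift /=; congr (_ *: (f _ - _)).
  by rewrite [t *: 1]mulr1 scalerDl addrA addrAC addrC [x + _]addrC addrA.
have gd (h : R) : is_derive h (1 : R) g ('D_D f (x + h *: D)).
  split; first by rewrite /derivable gE; exact: df.
  by rewrite /derive gE.
have gc : continuous g.
  by move=> h; apply/differentiable_continuous/derivable1_diffP; exact: ex_derive.
have g0 : g 0 = f x by rewrite /g scale0r addr0.
rewrite -g0 -/(g c); have [c0|c0] := leP 0 c.
- have [] := MVT_segment c0 (fun h _ => gd h) (continuous_subspaceT gc).
  move=> h /[!in_itv]/= /andP[h0 hc] ->; rewrite subr0 normrM ler_wpM2r// bf//.
    by rewrite !ger0_norm.
  by rewrite mulr_ge0.
- have [] := MVT_segment (ltW c0) (fun h _ => gd h) (continuous_subspaceT gc).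
  move=> h /[!in_itv]/= /andP[h0 hc]; rewrite distrC => ->.
  rewrite sub0r normrM normrN ler_wpM2r// bf//.
    by rewrite !ler0_norm ?lerN2// ltW.
  by rewrite mulr_le0// ltW.
Qed.

(** Go from x to y by changing one entry at a time.  Every segment travelled
    stays in the cube, where the partial derivatives are bounded by
    compactness, and the increments add up to the l1-distance. *)
Lemma C1_lipschitz_cube (R : realType) (m n : nat) (f : 'M[R]_(m, n) -> R^o)
    (B : R) : C1 f ->
  exists2 L : R, 0 <= L & forall x y : 'M[R]_(m, n),
    (forall i j, `|x i j| <= B) -> (forall i j, `|y i j| <= B) ->
    `|f y - f x| <= L * \sum_(p : 'I_m * 'I_n) `|y p.1 p.2 - x p.1 p.2|.
Proof.
move=> fC1.
pose K := [set M : 'M[R]_(m, n) | forall i j, `|M i j| <= B].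
have bnd p : exists2 M : R, 0 <= M & forall x, K x -> `|'D_(delta_mx p.1 p.2) f x| <= M.
  have : compact ((fun x => 'D_(delta_mx p.1 p.2) f x : R) @` K).
    apply: continuous_compact; last exact: compact_mx_cube.
    by apply: continuous_subspaceT; exact: (fC1 p.1 p.2).2.
  move=> /compact_bounded[N [Nr NB]].
  exists (`|N| + 1) => [|x Kx]; first by rewrite addr_ge0.
  by apply: (NB (`|N| + 1)); [rewrite ltr_pwDr// ler_norm|exists x].
pose M p := s2val (cid2 (bnd p)).
have M0 p : 0 <= M p by rewrite /M; case: cid2.
have MK p x : K x -> `|'D_(delta_mx p.1 p.2) f x| <= M p.
  by rewrite /M; case: cid2 => /= ? _; exact.
exists (\sum_p M p) => [|x y Kx Ky]; first by rewrite sumr_ge0.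
pose h (s : seq ('I_m * 'I_n)) : 'M[R]_(m, n) :=
  \matrix_(i, j) (if (i, j) \in s then y i j else x i j).
have step s : uniq s ->
    `|f (h s) - f x| <= (\sum_p M p) * \sum_(p <- s) `|y p.1 p.2 - x p.1 p.2|.
  elim: s => [_|p s IH /= /andP[ps us]].
    rewrite big_nil mulr0 (_ : h [::] = x) ?subrr ?normr0//.
    by apply/matrixP => i j; rewrite mxE.
  rewrite big_cons mulrDr.
  have -> : h (p :: s) = h s + (y p.1 p.2 - x p.1 p.2) *: delta_mx p.1 p.2.
    apply/matrixP => i j; rewrite !mxE inE.
    have [eq_p|ne_p] := eqVneq (i, j) p.
      rewrite eq_p (negbTE ps) -eq_p /= !eqxx.
      by rewrite mulr1 addrC subrK.
    rewrite (_ : (i == p.1) && (j == p.2) = false) ?mulr0 ?addr0//.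
    by apply: contraNF ne_p => /andP[/eqP-> /eqP->]; case: (p).
  rewrite (le_trans (ler_distD (f (h s)) _ _))// lerD ?IH//.
  apply: partial_mean_value_le => [z|t tc t0]; first exact: (fC1 p.1 p.2).1.
  apply: (@le_trans _ _ (M p)); last first.
    by rewrite (bigD1 p)//= lerDl sumr_ge0.
  apply: MK => i j.
  rewrite !mxE; case: ifPn => ijs.
    rewrite (_ : (i == p.1) && (j == p.2) = false) ?mulr0 ?addr0//.
    by apply: contraNF ps => /andP[/eqP ip /eqP jp]; move: ijs; rewrite ip jp; case: (p).
  have [/andP[/eqP-> /eqP->]|_] := boolP ((i == p.1) && (j == p.2));
    last by rewrite mulr0 addr0.
  rewrite mulr1; move: tc t0 (Kx p.1 p.2) (Ky p.1 p.2).
  move: (x _ _) (y _ _) => a b; rewrite !ler_norml.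
  have [ab|ab|->] := ltgtP (b - a) 0; last 1 first.
  - by rewrite normr0 !oppr0 => /andP[? ?] _ /andP[? ?] _; apply/andP; split; lra.
  - rewrite ltr0_norm// nmulr_lge0// => /andP[? ?] ? /andP[? ?] /andP[? ?].
    by apply/andP; split; lra.
  - rewrite gtr0_norm// pmulr_lge0// => /andP[? ?] ? /andP[? ?] /andP[? ?].
    by apply/andP; split; lra.
rewrite {1}(_ : y = h (index_enum _)); first exact/step/index_enum_uniq.
by apply/matrixP => i j; rewrite mxE mem_index_enum.
Qed.

(** * Integration over C^d *)

(** The integral of a nonnegative function is a supremum over the simple
    functions below it, so it is monotone even for functions that are not
    measurable; this spares proving the integrand of I measurable. *)
Lemma ge0_le_integralT d (T : measurableType d) (R : realType)
    (mu : {measure set T -> \bar R}) (f g : T -> \bar R) :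
  (forall x, 0 <= f x)%E -> (forall x, f x <= g x)%E ->
  (\int[mu]_x f x <= \int[mu]_x g x)%E.
Proof.
move=> f0 fg; rewrite !ge0_integralTE//; last first.
  by move=> x; exact: le_trans (fg x).
apply: ereal_sup_le => _ [h hf <-]; exists h => //= x; exact: le_trans (hf x) (fg x).
Qed.

Definition Cbox (R : realType) (d : nat) (a b : 'I_d -> R) (h : R) :
    set (d.-tuple (measurableTypeR R * measurableTypeR R)) :=
  [set p | forall j, (`[a j, a j + h] `*` `[b j, b j + h]) (tnth p j)].

Lemma measurable_Cbox (R : realType) d (a b : 'I_d -> R) h :
  measurable (Cbox a b h).
Proof.
rewrite (_ : Cbox a b h = \bigcap_(j in [set: 'I_d])
    ((fun p => tnth p j) @^-1` (`[a j, a j + h] `*` `[b j, b j + h]))).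
  apply: fin_bigcap_measurable => [|j _]; first exact: finite_finset.
  rewrite -[X in measurable X]setTI; apply: measurable_tnth => //.
  exact: measurableX.
by apply/seteqP; split=> [p H j _|p H j]; [exact: H|exact: (H j)].
Qed.

Lemma lebesgue_Cd_Cbox (R : realType) d (a b : 'I_d -> R) h : 0 <= h ->
  lebesgue_Cd R d (Cbox a b h) = (h ^+ (2 * d))%:E.
Proof.
move=> h0.
have mB j : measurable (`[a j, a j + h]%classic `*` `[b j, b j + h]%classic :
    set (measurableTypeR R * measurableTypeR R)) by exact: measurableX.
rewrite [LHS](tuple_measure_box (lebesgue_C R) mB).
have itv (x : R) : lebesgue_measure (`[x, x + h]%classic : set R) = h%:E.
  rewrite lebesgue_measure_itv/= lte_fin ltrDl -EFinB addrAC subrr add0r.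
  by case: ltgtP h0 => // <-.
rewrite (eq_bigr (fun=> (h ^+ 2)%:E)) => [|j _].
  by rewrite prodEFin prodr_const card_ord exprM.
rewrite [LHS](@product_measure1E _ _ _ _ _ lebesgue_measure lebesgue_measure)//.
rewrite expr2 EFinM; congr (_ * _)%E; exact: itv.
Qed.

Lemma integral_ge_Cbox (R : realType) d (a b : 'I_d -> R) (h c : R)
    (f : d.-tuple (measurableTypeR R * measurableTypeR R) -> \bar R) :
  0 <= h -> 0 <= c -> (forall p, 0 <= f p)%E ->
  (forall p, Cbox a b h p -> c%:E <= f p)%E ->
  ((c * h ^+ (2 * d))%:E <= \int[lebesgue_Cd R d]_p f p)%E.
Proof.
move=> h0 c0 f0 cf.
rewrite EFinM -(@lebesgue_Cd_Cbox _ _ a b)// -integral_cst; last exact: measurable_Cbox.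
rewrite integral_mkcond; apply: ge0_le_integralT => p; rewrite patchE; case: ifPn => //.
by rewrite inE => /cf.
Qed.

Lemma pow2_bracket (R : realType) (t : R) : 1 <= t ->
  exists k, 2 ^+ k <= t < 2 ^+ k.+1.
Proof.
move=> t1.
have ex : exists n, t < 2 ^+ n.
  exists (Num.bound t); rewrite (lt_le_trans (archi_boundP _))//; last first.
    by rewrite -natrX ler_nat ltnW// ltn_expl.
  exact: le_trans t1.
case: (ex_minnP ex) => -[|k] tk kmin; first by move: tk; rewrite expr0 ltNge t1.
exists k; rewrite tk andbT leNgt; apply/negP => /kmin.
by rewrite ltnn.
Qed.

(** Decay of order 2d + 1 in real dimension 2d is integrable.  The function is
    dominated by a series of multiples of indicators of cubes: the k-th cube has
    side 2^{k+2} and contains the points where 2^k <= T < 2^{k+1}; its term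
    contributes C 16^d 2^{-k}. *)
Lemma integral_decay_le (R : realType) d (C : R)
    (T : d.-tuple (measurableTypeR R * measurableTypeR R) -> R)
    (f : d.-tuple (measurableTypeR R * measurableTypeR R) -> \bar R) :
  0 <= C -> (forall p, 1 <= T p) ->
  (forall p j, `|(tnth p j).1| <= T p /\ `|(tnth p j).2| <= T p) ->
  (forall p, 0 <= f p)%E ->
  (forall p, f p <= (C / T p ^+ (2 * d).+1)%:E)%E ->
  (\int[lebesgue_Cd R d]_p f p <= (C * (2 * 16 ^+ d))%:E)%E.
Proof.
move=> C0 T1 pT f0 fT.
pose B k := Cbox (fun=> - 2 ^+ k.+1 : R) (fun=> - 2 ^+ k.+1 : R) (2 ^+ k.+2) : set (d.-tuple _).
pose c k := C / (2 ^+ k) ^+ (2 * d).+1.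
have c0 k : 0 <= c k by rewrite divr_ge0// !exprn_ge0.
pose g k p := (c k * \1_(B k) p)%:E.
have g0 k p : (0 <= g k p)%E by rewrite lee_fin mulr_ge0.
apply: (@le_trans _ _ (\int[lebesgue_Cd R d]_p (\sum_(k <oo) g k p))%E).
  apply: ge0_le_integralT => // p; rewrite (le_trans (fT p))//.
  have [k /andP[kT Tk]] := pow2_bracket (T1 p).
  (* The single term of index k already dominates f p. *)
  apply: (@le_trans _ _ (g k p)).
    rewrite lee_fin indicE mem_set ?mulr1.
      rewrite ler_wpM2l// lef_pV2 ?posrE ?exprn_gt0// ?(lt_le_trans _ (T1 p))//.
      by rewrite lerXn2r// ?nnegrE ?exprn_ge0// (le_trans _ (T1 p)).
    move=> j; have [] := pT p j => p1 p2.
    have -> : - 2 ^+ k.+1 + 2 ^+ k.+2 = 2 ^+ k.+1 :> R by rewrite [_ ^+ k.+2]exprS; ring.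
    by split; rewrite /= in_itv/= -ler_norml; exact: le_trans (ltW Tk).
  by rewrite (@nneseriesD1 _ _ k)// leeDl// nneseries_ge0.
rewrite integral_nneseries//; last first.
  move=> k; rewrite /g; apply/measurable_EFinP/measurable_funM => //.
  by apply: measurable_indic; exact: measurable_Cbox.
rewrite (@eq_eseriesr _ _ (fun k => ((C * (2 * 16 ^+ d)) / (2 ^ (k + 1))%:R)%:E)); last first.
  move=> k _; rewrite /g (@integralZl_indic _ _ _ _ _ measurableT (fun=> B k))//; last 2 first.
  - by rewrite ltNge c0.
  - exact: measurable_Cbox.
  rewrite integral_indic//; last exact: measurable_Cbox.
  transitivity ((c k)%:E * ((2 ^+ k.+2) ^+ (2 * d))%:E)%E.
    by congr (_ * _)%E; rewrite setIT; apply: lebesgue_Cd_Cbox; rewrite exprn_ge0.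
  rewrite -EFinM; congr EFin; rewrite /c natrX addn1.
  rewrite (_ : 2 ^+ k.+2 = 4 * 2 ^+ k :> R); last by rewrite !exprS; ring.
  rewrite [2 ^+ k.+1]exprS exprMn (exprM 4) (_ : 4 ^+ 2 = 16 :> R); last by ring.
  have : 2 ^+ k != 0 :> R by rewrite expf_neq0.
  rewrite exprS; move: (2 ^+ k) => x x0.
  have : x ^+ (2 * d) != 0 by rewrite expf_neq0.
  by move: (x ^+ (2 * d)) (16 ^+ d) => y z y0; field; rewrite x0 y0.
have := cvg_lim _ (@cvg_geometric_eseries_half R (C * (2 * 16 ^+ d)) 0).
by rewrite expr0 divr1 => ->.
Qed.

(** * Moduli, monomials and continuity on C^d *)

Lemma normc_monomial (R : realType) d (alpha : 'rV[nat]_d) (z : 'rV[complex R]_d) :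
  normc (monomial alpha z) = \prod_j normc (z 0 j) ^+ alpha 0 j.
Proof.
rewrite /monomial; elim/big_ind2 : _ => [|x1 x2 y1 y2|j _]; first exact: normc1.
  by move=> <- <-; exact: normcM.
by elim: (alpha 0 j) => [|n IH]; rewrite ?expr0 ?normc1// !exprS normcM IH.
Qed.

Lemma normc_real_complex (R : realType) (x : R) : 0 <= x ->
  normc (real_complex R x) = x.
Proof. by move=> x0; rewrite /normc /= expr0n/= addr0 sqrtr_sqr ger0_norm. Qed.

Lemma normc_ge_coord (R : realType) (x y : R) :
  `|x| <= normc (Complex x y) /\ `|y| <= normc (Complex x y).
Proof.
by split; rewrite /normc -sqrtr_sqr ler_wsqrtr// ?lerDl ?lerDr sqr_ge0.
Qed.

Lemma normc_ge0 (R : realType) (z : complex R) : 0 <= normc z.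
Proof. by case: z => x y; rewrite /normc sqrtr_ge0. Qed.

Lemma normc_le_enorm (R : realType) d (z : 'rV[complex R]_d) j :
  normc (z 0 j) <= enorm z.
Proof.
rewrite /enorm -[leLHS]ger0_norm ?normc_ge0// -sqrtr_sqr ler_wsqrtr//.
by rewrite (bigD1 j)//= lerDl sumr_ge0// => i _; exact: sqr_ge0.
Qed.

(** The bound eta <= 1 keeps w in the cube of radius B + 1, where the Lipschitz
    bound is applied. *)
Lemma C2_Cd_unif_continuous_cube (R : realType) d (Q : 'rV[complex R]_d -> R)
    (B e : R) : C2_Cd Q -> 0 < e ->
  exists2 eta : R, 0 < eta <= 1 & forall z w : 'rV[complex R]_d,
    (forall j, `|complex.Re (z 0 j)| <= B /\ `|complex.Im (z 0 j)| <= B) ->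
    (forall j, `|complex.Re (w 0 j) - complex.Re (z 0 j)| <= eta /\
               `|complex.Im (w 0 j) - complex.Im (z 0 j)| <= eta) ->
    `|Q w - Q z| <= e.
Proof.
move=> [QC1 _] e0.
have [L L0 QL] := C1_lipschitz_cube (B + 1) QC1.
pose N : R := L * (d * 2)%:R + 1.
have N0 : 0 < N by rewrite ltr_wpDl// mulr_ge0.
exists (Num.min 1 (e / N)).
  by rewrite lt_min ltr01 divr_gt0//= ge_min lexx.
move=> z w zB wz.
pose mx (v : 'rV[complex R]_d) : 'M[R]_(d, 2) :=
  \matrix_(j, k) (if k == 0 then complex.Re (v 0 j) else complex.Im (v 0 j)).
have mxK v : mx_to_C (mx v) = v.
  by apply/rowP => j; rewrite !mxE /=; case: (v 0 j).
have zwB j k : `|mx z j k| <= B + 1 /\ `|mx w j k - mx z j k| <= Num.min 1 (e / N).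
  by rewrite !mxE; have [? ?] := zB j; have [? ?] := wz j; case: ifP => _; split=> //; lra.
have := QL (mx z) (mx w); rewrite !mxK => /(_ _ _)/le_trans; apply.
- by move=> j k; have [] := zwB j k.
- move=> j k; have [zb wb] := zwB j k.
  rewrite -[mx w j k](subrK (mx z j k)) (le_trans (ler_normD _ _))//.
  have : `|mx z j k| <= B.
    by rewrite !mxE; have [? ?] := zB j; case: ifP.
  move: wb; rewrite le_min => /andP[wb _]; lra.
apply: (@le_trans _ _ (L * \sum_(p : 'I_d * 'I_2) (e / N))).
  rewrite ler_wpM2l// ler_sum// => p _.
  have [_] := zwB p.1 p.2; rewrite le_min => /andP[_ /le_trans]; exact.
rewrite sumr_const card_prod !card_ord -mulr_natr.
rewrite (_ : L * _ = e * ((N - 1) / N)); last by rewrite /N; ring.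
by rewrite ler_piMr ?(ltW e0)// ler_pdivrMr// mul1r gerBl.
Qed.

(** * The Legendre transform and pointwise bounds *)

(** Truncating the Euclidean norm from below makes its logarithm nonnegative and
    lets the growth condition hold on all of C^d, up to a constant. *)
Definition tnorm (R : realType) d (r0 : R) (z : 'rV[complex R]_d) : R :=
  Num.max (enorm z) r0.

(** Below r0 the left-hand side vanishes, so there the bound is Q >= 0. *)
Lemma growth_tnorm (R : realType) d (Q : 'rV[complex R]_d -> R) (eps r0 : R)
    (z : 'rV[complex R]_d) :
  (forall z, 0 <= Q z) -> 0 < eps -> 1 <= r0 ->
  (forall z, r0 <= enorm z -> (1 + eps) * ln (enorm z) <= Q z) ->
  (1 + eps) * (ln (tnorm r0 z) - ln r0) <= Q z.
Proof.
move=> Q0 eps0 r1 Qg; rewrite /tnorm; case: (leP (enorm z) r0) => [_|/ltW zr].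
  by rewrite subrr mulr0.
rewrite (le_trans _ (Qg z zr))// ler_wpM2l ?addr_ge0 ?(ltW eps0)// gerBl.
exact: ln_ge0.
Qed.

Lemma prod_le_exp_tnorm (R : realType) d (r0 : R) (alpha : 'rV[nat]_d) n
    (z : 'rV[complex R]_d) : 1 <= r0 -> (\sum_j alpha 0%R j <= n)%N ->
  normc (monomial alpha z) <= expR (n%:R * ln (tnorm r0 z)).
Proof.
move=> r1 alphan; rewrite normc_monomial.
have T1 : 1 <= tnorm r0 z by rewrite le_max r1 orbT.
rewrite expRM_natl lnK ?posrE ?(lt_le_trans _ T1)//.
apply: (le_trans _ (ler_weXn2l T1 alphan)); rewrite -prodrXr.
apply: ler_prod => j _; rewrite exprn_ge0 ?normc_ge0//= lerXn2r ?nnegrE ?normc_ge0//.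
  exact: le_trans T1.
by rewrite le_max normc_le_enorm.
Qed.

Lemma sum_simplex_le_tnorm (R : realType) d (r0 : R) (t s : 'rV[R]_d) :
  1 <= r0 -> simplex R d t ->
  \sum_j t 0 j * s 0 j <= ln (tnorm r0 (map_mx (fun x => real_complex R (expR x)) s)).
Proof.
move=> r1 [t0 t1]; set z := map_mx _ s.
have T1 : 1 <= tnorm r0 z by rewrite le_max r1 orbT.
apply: (@le_trans _ _ (\sum_j t 0 j * ln (tnorm r0 z))).
  apply: ler_sum => j _; rewrite ler_wpM2l//.
  rewrite -ler_expR lnK ?posrE ?(lt_le_trans _ T1)// le_max; apply/orP; left.
  by apply: le_trans (normc_le_enorm z j); rewrite mxE normc_real_complex// expR_ge0.
by rewrite -mulr_suml ler_piMl// ln_ge0.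
Qed.

(** Since <t,s> <= ln T on the simplex, the growth of Q leaves a multiple of
    - ln T.  The bound shows that u is finite and confines the near-maximizers
    of u to a bounded region. *)
Lemma legendre_term_le (R : realType) d (Q : 'rV[complex R]_d -> R) (eps r0 : R)
    (t s : 'rV[R]_d) :
  (forall z, 0 <= Q z) -> 0 < eps -> 1 <= r0 ->
  (forall z, r0 <= enorm z -> (1 + eps) * ln (enorm z) <= Q z) ->
  simplex R d t ->
  \sum_j t 0 j * s 0 j - qexp Q s <= (1 + eps) * ln r0 -
    eps * ln (tnorm r0 (map_mx (fun x => real_complex R (expR x)) s)).
Proof.
move=> Q0 eps0 r1 Qg tS.
have := growth_tnorm (map_mx (fun x => real_complex R (expR x)) s) Q0 eps0 r1 Qg.
have := sum_simplex_le_tnorm s r1 tS.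
by rewrite /qexp; lra.
Qed.

Lemma u_fun_fin (R : realType) d (Q : 'rV[complex R]_d -> R) (eps r0 : R)
    (t : 'rV[R]_d) :
  (forall z, 0 <= Q z) -> 0 < eps -> 1 <= r0 ->
  (forall z, r0 <= enorm z -> (1 + eps) * ln (enorm z) <= Q z) ->
  simplex R d t ->
  exists2 U, u_fun Q t = U%:E & - qexp Q 0 <= U.
Proof.
move=> Q0 eps0 r1 Qg tS.
have ub : (u_fun Q t <= ((1 + eps) * ln r0)%:E)%E.
  apply: ge_ereal_sup => _ [s _ <-]; rewrite lee_fin.
  rewrite (le_trans (legendre_term_le s Q0 eps0 r1 Qg tS))// gerBl.
  by rewrite mulr_ge0 ?(ltW eps0)// ln_ge0// le_max r1 orbT.
have lb : ((- qexp Q 0)%:E <= u_fun Q t)%E.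
  apply: ereal_sup_ubound; exists 0 => //; congr EFin.
  by rewrite big1 ?sub0r// => j _; rewrite mxE mulr0.
case: (u_fun Q t) ub lb => [U| |]//; rewrite !lee_fin => _ ?.
by exists U.
Qed.

(** When some coordinate of z vanishes, log |z| is not a point of R^d.  Adding
    eta > 0 to all moduli increases the monomial and, by torus invariance and
    continuity, changes Q(z) by an arbitrarily small amount. *)
Lemma monomial_le_u_fun (R : realType) d (Q : 'rV[complex R]_d -> R)
    (n : nat) (alpha : 'rV[nat]_d) (t : 'rV[R]_d) (U : R) (z : 'rV[complex R]_d) :
  C2_Cd Q -> torus_invariant Q -> (0 < n)%N -> n%:R *: t = natv R alpha ->
  u_fun Q t = U%:E ->
  normc (monomial alpha z) <= expR (n%:R * (U + Q z)).
Proof.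
move=> QC2 Qtorus n0 ntE uU; have [|P0] := leP (normc (monomial alpha z)) 0.
  by move=> /le_trans; apply; exact: expR_ge0.
rewrite -[leLHS]lnK ?posrE// ler_expR -ler_pdivrMl ?ltr0n//.
apply/ler_addgt0Pr => e e0.
have [eta /andP[eta0 _] Qeta] := C2_Cd_unif_continuous_cube (enorm z) QC2 e0.
pose s : 'rV[R]_d := \row_j ln (normc (z 0 j) + eta).
have zeta0 j : 0 < normc (z 0 j) + eta by rewrite ltr_wpDl ?normc_ge0.
have Qs : qexp Q s <= Q z + e.
  rewrite /qexp [Q z]Qtorus -lerBlDl (le_trans (ler_norm _))//.
  apply: Qeta => j; rewrite !mxE /=.
    rewrite normr0 ger0_norm ?normc_ge0//.
    by split; [exact: normc_le_enorm|exact: sqrtr_ge0].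
  rewrite subrr normr0 lnK ?posrE// [_ + eta]addrC addrK gtr0_norm//.
  by split=> //; exact: ltW.
have Us : \sum_j t 0 j * s 0 j <= U + qexp Q s.
  by rewrite -lerBlDr -lee_fin -uU; apply: ereal_sup_ubound; exists s.
apply: (@le_trans _ _ (\sum_j t 0 j * s 0 j)); last by rewrite -addrA; lra.
rewrite ler_pdivrMl ?ltr0n// -ler_expR lnK ?posrE// normc_monomial mulr_sumr expR_sum.
apply: ler_prod => j _; rewrite exprn_ge0 ?normc_ge0//=.
have -> : n%:R * (t 0 j * s 0 j) = (alpha 0 j)%:R * s 0 j.
  by rewrite mulrA; congr (_ * _); move/matrixP/(_ 0 j): ntE; rewrite !mxE.
rewrite expRM_natl mxE lnK ?posrE// lerXn2r ?nnegrE ?normc_ge0 ?(ltW (zeta0 _))//.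
by rewrite lerDl ltW.
Qed.

(** * Bounds on the integrals *)

(** The exponent on the right is n times a convex combination of U and V. *)
Lemma exp_interpolate (R : realType) (P U V : R) (m n : nat) :
  (0 < n)%N -> (m <= n)%N ->
  P <= expR (n%:R * U) -> P <= expR (n%:R * V) ->
  P <= expR ((n - m)%:R * U + m%:R * V).
Proof.
move=> n0 mn; have [P0|P0] := leP P 0.
  by move=> _ _; apply: le_trans P0 _; exact: expR_ge0.
rewrite -[P]lnK ?posrE// !ler_expR -!ler_pdivrMl ?ltr0n// => PU PV.
have -> : ln P = (n - m)%:R * (n%:R^-1 * ln P) + m%:R * (n%:R^-1 * ln P).
  by rewrite -mulrDl -natrD subnK// mulVKf// pnatr_eq0 -lt0n.
by rewrite lerD// ler_wpM2l.
Qed.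

Lemma tuple_to_C_tnth (R : realType) d
    (p : d.-tuple (measurableTypeR R * measurableTypeR R)) j :
  tuple_to_C p 0 j = Complex (tnth p j).1 (tnth p j).2.
Proof. by rewrite mxE. Qed.

Lemma I_int_integrandE (R : realType) d (Q : 'rV[complex R]_d -> R)
    (alpha : 'rV[nat]_d) (n : nat) z :
  normc (monomial alpha z) ^+ 2 * expR (- (2 * n%:R * Q z)) =
  (normc (monomial alpha z) * expR (- (n%:R * Q z))) ^+ 2.
Proof. by rewrite exprMn -expRM_natl; congr (_ * expR _); ring. Qed.

(** The number m of factors bounded through the growth of Q is chosen so that
    T^{-2m eps} decays with order at least 2d + 1. *)
Lemma I_int_le (R : realType) d (Q : 'rV[complex R]_d -> R) (eps r0 : R)
    (m n : nat) (alpha : 'rV[nat]_d) (t : 'rV[R]_d) (U : R) :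
  (forall z, 0 <= Q z) -> C2_Cd Q -> torus_invariant Q -> 0 < eps -> 1 <= r0 ->
  (forall z, r0 <= enorm z -> (1 + eps) * ln (enorm z) <= Q z) ->
  (0 < n)%N -> (m <= n)%N -> (2 * d).+1%:R <= 2 * m%:R * eps ->
  simplex R d t -> n%:R *: t = natv R alpha -> u_fun Q t = U%:E ->
  (I_int Q alpha n <= (expR (2 * (n - m)%:R * U + 2 * m%:R * ((1 + eps) * ln r0))
                       * (2 * 16 ^+ d))%:E)%E.
Proof.
move=> Q0 QC2 Qtorus eps0 r1 Qg n0 mn meps tS ntE uU.
have alphan : (\sum_j alpha 0%R j <= n)%N.
  rewrite -(ler_nat R) natr_sum; case: tS => _ t1.
  rewrite -[leRHS]mulr1; apply: (le_trans _ (ler_wpM2l (ler0n _ n) t1)).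
  rewrite mulr_sumr ler_sum// => j _.
  by move/matrixP/(_ 0 j): ntE; rewrite !mxE => ->.
have T1 (z : 'rV[complex R]_d) : 1 <= tnorm r0 z by rewrite le_max r1 orbT.
apply: (@integral_decay_le _ _ _ (fun p => tnorm r0 (tuple_to_C p))) => //.
- move=> p j; have /= [re im] := normc_ge_coord (tnth p j).1 (tnth p j).2.
  have := normc_le_enorm (tuple_to_C p) j; rewrite tuple_to_C_tnth => nT.
  by split; rewrite le_max; apply/orP; left; [exact: le_trans re nT|exact: le_trans im nT].
- by move=> p; rewrite lee_fin mulr_ge0 ?expR_ge0// sqr_ge0.
move=> p; rewrite lee_fin; move: (tuple_to_C p) => z.
rewrite I_int_integrandE; set P := normc _ * _.
set A := (1 + eps) * ln r0.
have PU : P <= expR (n%:R * U).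
  have := monomial_le_u_fun z QC2 Qtorus n0 ntE uU.
  move=> /(ler_wpM2r (expR_ge0 (- (n%:R * Q z))))/le_trans; apply.
  by rewrite -expRD ler_expR; lra.
have PV : P <= expR (n%:R * (A - eps * ln (tnorm r0 z))).
  have := prod_le_exp_tnorm z r1 alphan.
  move=> /(ler_wpM2r (expR_ge0 (- (n%:R * Q z))))/le_trans; apply.
  rewrite -expRD ler_expR -mulrBr ler_wpM2l//.
  by have := growth_tnorm z Q0 eps0 r1 Qg; rewrite /A; lra.
have P0 : 0 <= P by rewrite mulr_ge0 ?normc_ge0 ?expR_ge0.
have PUV := exp_interpolate n0 mn PU PV.
apply: (@le_trans _ _ (expR ((n - m)%:R * U +
    m%:R * (A - eps * ln (tnorm r0 z))) ^+ 2)).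
  by rewrite lerXn2r ?nnegrE ?expR_ge0.
rewrite -expRM_natl -[tnorm r0 z in leRHS]lnK ?posrE ?(lt_le_trans _ (T1 z))//.
rewrite -expRM_natl -expRN -expRD ler_expR.
have := ler_wpM2r (ln_ge0 (T1 z)) meps.
by rewrite /A; lra.
Qed.

(** The constant c, which is the volume eta^{2d} of a cube, depends neither on
    alpha nor on n: the near-maximizer e^s moves with t, but stays in a ball of
    fixed radius B, so a single eta serves all of them. *)
Lemma I_int_ge (R : realType) d (Q : 'rV[complex R]_d -> R) (eps r0 delta : R) :
  (forall z, 0 <= Q z) -> C2_Cd Q -> 0 < eps -> 1 <= r0 ->
  (forall z, r0 <= enorm z -> (1 + eps) * ln (enorm z) <= Q z) ->
  0 < delta ->
  exists2 c : R, 0 < c & forall n alpha t U,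
    simplex R d t -> n%:R *: t = natv R alpha -> u_fun Q t = U%:E ->
    ((c * expR (2 * n%:R * (U - delta)))%:E <= I_int Q alpha n)%E.
Proof.
move=> Q0 QC2 eps0 r1 Qg delta0.
pose B := expR (((1 + eps) * ln r0 + qexp Q 0 + delta) / eps).
have d20 : 0 < delta / 2 by rewrite divr_gt0.
have [eta /andP[eta0 _] Qeta] := C2_Cd_unif_continuous_cube B QC2 d20.
exists (eta ^+ (2 * d)); first by rewrite exprn_gt0.
move=> n alpha t U tS ntE uU.
have [s Us] : exists s : 'rV[R]_d, U - delta / 2 < \sum_j t 0 j * s 0 j - qexp Q s.
  have : ((U - delta / 2)%:E < u_fun Q t)%E by rewrite uU lte_fin gtrBl.
  by move=> /ereal_sup_gt[_ [s _ <-]]; rewrite lte_fin => ?; exists s.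
pose r : 'rV[complex R]_d := map_mx (fun x => real_complex R (expR x)) s.
have rB j : expR (s 0 j) <= B.
  apply: (@le_trans _ _ (tnorm r0 r)).
    rewrite le_max; apply/orP; left; apply: le_trans (normc_le_enorm r j).
    by rewrite mxE normc_real_complex// expR_ge0.
  have T0 : 0 < tnorm r0 r by rewrite lt_max (lt_le_trans _ r1) ?orbT.
  rewrite -[leLHS]lnK ?posrE// ler_expR ler_pdivlMr// mulrC.
  have := legendre_term_le s Q0 eps0 r1 Qg tS.
  have [U' uU' U'Q] := u_fun_fin Q0 eps0 r1 Qg tS.
  have : U' = U by move: uU'; rewrite uU => -[].
  by rewrite -/r; lra.
(* The cube is z_j in [e^{s_j}, e^{s_j} + eta] + i [0, eta]. *)
rewrite mulrC; apply: (@integral_ge_Cbox _ _ (fun j => expR (s 0 j)) (fun=> 0)).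
- exact: ltW.
- exact: expR_ge0.
- by move=> p; rewrite lee_fin mulr_ge0 ?expR_ge0// sqr_ge0.
move=> p pB; rewrite lee_fin.
have {}pB j : [/\ expR (s 0 j) <= (tnth p j).1, (tnth p j).1 <= expR (s 0 j) + eta,
    0 <= (tnth p j).2 & (tnth p j).2 <= eta].
  have := pB j; case: (tnth p j) => x y [] /=; rewrite !in_itv/= add0r.
  by move=> /andP[? ?] /andP[? ?].
set z := tuple_to_C p.
have Qz : Q z <= qexp Q s + delta / 2.
  rewrite -lerBlDl (le_trans (ler_norm _))//.
  apply: Qeta => j; rewrite !mxE/=.
    by rewrite normr0 ger0_norm ?expR_ge0// rB; split=> //; exact: expR_ge0.
  have [p1 p2 p3 p4] := pB j; rewrite subr0 (ger0_norm p3); split=> //.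
  by rewrite ger0_norm ?subr_ge0// lerBlDl.
have mz : expR (n%:R * \sum_j t 0 j * s 0 j) <= normc (monomial alpha z).
  rewrite normc_monomial mulr_sumr expR_sum; apply: ler_prod => j _.
  rewrite expR_ge0 /=.
  have -> : n%:R * (t 0 j * s 0 j) = (alpha 0 j)%:R * s 0 j.
    by rewrite mulrA; congr (_ * _); move/matrixP/(_ 0 j): ntE; rewrite !mxE.
  rewrite expRM_natl lerXn2r ?nnegrE ?normc_ge0 ?expR_ge0//.
  have [p1 _ _ _] := pB j; rewrite tuple_to_C_tnth.
  apply: (le_trans p1); apply: le_trans (normc_ge_coord _ _).1.
  exact: ler_norm.
rewrite I_int_integrandE.
apply: (@le_trans _ _ ((expR (n%:R * \sum_j t 0 j * s 0 j) * expR (- (n%:R * Q z))) ^+ 2)).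
  rewrite -expRD -expRM_natl ler_expR -mulrA ler_wpM2l// -mulrBr ler_wpM2l//.
  lra.
rewrite lerXn2r ?nnegrE ?mulr_ge0 ?expR_ge0 ?normc_ge0//.
by rewrite ler_wpM2r ?expR_ge0.
Qed.

(** * Uniform logarithmic asymptotics *)

Lemma I_int_log_asymptotics (R : realType) d (Q : 'rV[complex R]_d -> R)
    (eps r0 delta : R) :
  (forall z, 0 <= Q z) -> C2_Cd Q -> torus_invariant Q -> 0 < eps -> 1 <= r0 ->
  (forall z, r0 <= enorm z -> (1 + eps) * ln (enorm z) <= Q z) ->
  0 < delta ->
  exists N, forall n alpha, (N <= n)%N -> lattice_pts R d n alpha ->
    exists I U, [/\ (0 < n)%N, I_int Q alpha n = I%:E, 0 < I,
      u_fun Q (n%:R^-1 *: natv R alpha) = U%:E &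
      `|(2 * n%:R)^-1 * ln I - U| <= delta].
Proof.
move=> Q0 QC2 Qtorus eps0 r1 Qg delta0.
have d20 : 0 < delta / 2 by rewrite divr_gt0.
have [c c0 cI] := I_int_ge Q0 QC2 eps0 r1 Qg d20.
pose m := Num.bound ((2 * d).+1%:R / (2 * eps)).
have meps : (2 * d).+1%:R <= 2 * m%:R * eps.
  rewrite mulrAC -ler_pdivrMl ?mulr_gt0// mulrC ltW// archi_boundP//.
  by rewrite divr_ge0// mulr_ge0// ltW.
pose K : R := 2 * m%:R * ((1 + eps) * ln r0) + ln (2 * 16 ^+ d).
pose M := `|2 * m%:R * qexp Q 0 + K| + `|ln c|.
(* M dominates the errors in ln I coming from both bounds, hence M <= n delta
   is enough. *)
exists (maxn m.+1 (Num.bound (M / delta))) => n alpha.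
rewrite geq_max => /andP[mn Mn] [t tS ntE].
have n0 : (0 < n)%N by exact: leq_ltn_trans mn.
have nR0 : 0 < n%:R :> R by rewrite ltr0n.
have {}Mn : M <= n%:R * delta.
  rewrite -ler_pdivrMr// (le_trans (ltW (archi_boundP _))) ?ler_nat//.
  by rewrite divr_ge0 ?addr_ge0// ltW.
have [U uU QU] := u_fun_fin Q0 eps0 r1 Qg tS.
have ub := I_int_le Q0 QC2 Qtorus eps0 r1 Qg n0 (ltnW mn) meps tS ntE uU.
have lb := cI _ _ _ _ tS ntE uU.
case EI : (I_int Q alpha n) ub lb => [I| |]//; rewrite !lee_fin => ub lb.
have I0 : 0 < I by apply: lt_le_trans lb; rewrite mulr_gt0// expR_gt0.
exists I, U; split=> //.
  by rewrite -ntE scalerA mulVf ?gt_eqF// scale1r.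
have lnI_ub : ln I <= 2 * (n - m)%:R * U + K.
  have K0 : 0 < 2 * 16 ^+ d :> R by rewrite mulr_gt0// exprn_gt0.
  have := ub; rewrite -[I <= _]ler_ln ?posrE ?(mulr_gt0 (expR_gt0 _) K0)//.
  by rewrite lnM ?posrE ?expR_gt0// expRK /K addrA.
have lnI_lb : ln c + 2 * n%:R * (U - delta / 2) <= ln I.
  have := lb; rewrite -[_ <= I]ler_ln ?posrE ?(mulr_gt0 c0 (expR_gt0 _))//.
  by rewrite lnM ?posrE ?expR_gt0// expRK.
have := ler_norm (2 * m%:R * qexp Q 0 + K).
have := ler_norm (- ln c); rewrite normrN.
have := normr_ge0 (ln c); have := normr_ge0 (2 * m%:R * qexp Q 0 + K).
have mQU : 2 * m%:R * - qexp Q 0 <= 2 * m%:R * U by rewrite ler_wpM2l// mulr_ge0.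
rewrite natrB ?(ltnW mn)// in lnI_ub.
move=> ? ? ? ?; rewrite /M in Mn.
have n20 : 0 < 2 * n%:R :> R by rewrite mulr_gt0.
rewrite ler_distl ler_pdivlMl// ler_pdivrMl//; apply/andP; split; lra.
Qed.

(** Nonemptiness matters: the supremum of the empty set is -oo. *)
Lemma ereal_sup_cvg0 (R : realType) (S : nat -> set (\bar R)) :
  (forall n, S n !=set0) ->
  (forall delta : R, 0 < delta -> exists N, forall n x, (N <= n)%N -> S n x ->
     (0 <= x <= delta%:E)%E) ->
  (fun n => ereal_sup (S n)) @ \oo --> 0%E.
Proof.
move=> S0 Sle.
have supS (delta : R) : 0 < delta -> exists N, forall n, (N <= n)%N ->
    (0 <= ereal_sup (S n) <= delta%:E)%E.
  move=> /Sle[N SN]; exists N => n Nn; apply/andP; split.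
    by have [x Sx] := S0 n; apply: le_ereal_sup_tmp; exists x => //; case/andP: (SN n x Nn Sx).
  by apply: ge_ereal_sup => x /(SN n x Nn)/andP[].
apply/fine_cvgP; split.
  have [N SN] := supS 1 ltr01; exists N => // n /SN /andP[s0 s1].
  by rewrite ge0_fin_numE// (le_lt_trans s1)// ltry.
apply/cvgrPdist_le => delta /supS[N SN]; exists N => // n /SN /= /andP[s0 s1].
rewrite sub0r normrN ger0_norm ?fine_ge0//.
by rewrite -lee_fin fineK// ge0_fin_numE// (le_lt_trans s1)// ltry.
Qed.

Theorem proposition5p7 (R : realType) (d : nat) (Q : 'rV[complex R]_d -> R)
    (eps r0 : R)
    (hd : (1 <= d)%N)
    (Q_ge0 : forall z, 0 <= Q z)
    (Q_C2 : C2_Cd Q)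
    (Q_torus : torus_invariant Q)
    (eps_gt0 : 0 < eps)
    (r0_ge1 : 1 <= r0)
    (Q_growth : forall z, r0 <= enorm z -> (1 + eps) * ln (enorm z) <= Q z) :
  (fun n : nat => ereal_sup
    [set `|(2 * n%:R)^-1%:E * lne (I_int Q alpha n)
           - u_fun Q (n%:R^-1 *: natv R alpha)|%E
    | alpha in lattice_pts R d n]) @ \oo --> 0%E /\
  (fun n : nat => ereal_sup
    [set `|n%:R^-1%:E * lne (c_coef Q alpha n)
           + u_fun Q (n%:R^-1 *: natv R alpha)|%E
    | alpha in lattice_pts R d n]) @ \oo --> 0%E.
Proof.
have lattice0 n : lattice_pts R d n 0.
  exists 0; last by apply/matrixP => i j; rewrite !mxE mulr0.
  by split=> [j|]; rewrite ?big1// => *; rewrite mxE.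
split; apply: ereal_sup_cvg0 => [n|delta delta0].
- by eexists; exists 0.
- have [N HN] := I_int_log_asymptotics Q_ge0 Q_C2 Q_torus eps_gt0 r0_ge1 Q_growth delta0.
  exists N => n _ Nn [alpha /(HN n alpha Nn) [I [U [n0 EI I0 -> IU]]] <-].
  by rewrite EI lne_EFin// -EFinM -EFinB abse_ge0 lee_fin.
- by eexists; exists 0.
have [N HN] := I_int_log_asymptotics Q_ge0 Q_C2 Q_torus eps_gt0 r0_ge1 Q_growth delta0.
exists N => n _ Nn [alpha /(HN n alpha Nn) [I [U [n0 EI I0 -> IU]]] <-].
rewrite /c_coef EI poweR_EFin lne_EFin ?powR_gt0// ln_powR -EFinM -EFinD abse_ge0 lee_fin.
rewrite (_ : _ + U = - ((2 * n%:R)^-1 * ln I - U)) ?normrN//.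
by rewrite invfM; ring.
Qed.
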